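(* Let $\Sigma=\{a,b\}$ and $L=\{a^nb^n y\mid n>0,\ y\in\Sigma^*\}$. No s-QRNN together with any decoder recognizes $L$: for every s-QRNN over $\Sigma$ (of any window length and dimension $k$) and every function $\mathbf d:\mathbb{Q}^k\to\{0,1\}$, it is not the case that for all $x\in\Sigma^*$, $\mathbf d(\mathbf h_{|x|})=1$ if and only if $x\in L$, where $\mathbf h_{|x|}$ is the final state of the s-QRNN on $x$.
   Context: QRNN of window length $w$ and dimension $k$: with an embedding $\Sigma\to\mathbb{Q}^{d_x}$, $x_t\mapsto\mathbf x_t$, and $\mathbf X$ the matrix of input vectors, let $\mathbf z_t,\mathbf f_t,\mathbf i_t,\mathbf o_t\in\mathbb{Q}^k$ be the rows of $\mathbf Z=\tanh(\mathbf W^z*\mathbf X)$, $\mathbf F=\sigma(\mathbf W^f*\mathbf X)$, $\mathbf I=\sigma(\mathbf W^i*\mathbf X)$, $\mathbf O=\sigma(\mathbf W^o*\mathbf X)$, where $*$ is convolution over time with window length $w$, rational weights $\mathbf W^\bullet\in\mathbb{Q}^{d_x\times w\times k}$, and rational biases allowed (so row $t$ is the activation applied to an affine function of $\mathbf x_{t-w+1},\dots,\mathbf x_t$, zero-padded before the start). Then $\mathbf c_0=\mathbf h_0=\mathbf 0$, $\mathbf c_t=\mathbf f_t\odot\mathbf c_{t-1}+\mathbf i_t\odot\mathbf z_t$, $\mathbf h_t=\mathbf o_t\odot\mathbf c_t$. Saturation: the s-QRNN is the QRNN in which $\sigma$ is replaced by the step function equal to $1$ on positive and $0$ on negative arguments,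 and $\tanh$ by the sign function with values in $\{-1,0,1\}$; parameters are such that no argument of a $\sigma$ is exactly $0$ on any input, so all gates lie in $\{0,1\}$. A decoder is a function from the final state to $\{0,1\}$ (accept $=1$, reject $=0$). *)

(* Defs.v *)
From mathcomp Require Import all_boot all_order all_algebra.

Set Implicit Arguments.
Unset Strict Implicit.
Unset Printing Implicit Defensive.

Import GRing.Theory Num.Theory.
Local Open Scope ring_scope.

(* [kernel j] is the d_x-by-k slice of the weight tensor applied to the j-th
   vector of the window, the last slice ([j = w - 1]) acting on the current
   input. *)
Record conv_layer (dx w k : nat) := ConvLayer {
  kernel : 'I_w -> 'M[rat]_(dx, k);
  bias : 'rV[rat]_k
}.

(* Time is numbered from 1.  Entry [t + j] of the sequence padded with [w]
   zeros is x_(t - w + 1 + j), with x_s = 0 for s <= 0. *)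
Definition conv (dx w k : nat) (l : conv_layer dx w k)
    (X : seq 'rV[rat]_dx) (t : nat) : 'rV[rat]_k :=
  \sum_(j < w) nth 0 (nseq w 0 ++ X) (t + j)%N *m kernel l j + bias l.

Record qrnn (S : Type) (dx w k : nat) := QRNN {
  embed : S -> 'rV[rat]_dx;
  layer_z : conv_layer dx w k;
  layer_f : conv_layer dx w k;
  layer_i : conv_layer dx w k;
  layer_o : conv_layer dx w k
}.

Definition odot (k : nat) (u v : 'rV[rat]_k) : 'rV[rat]_k := map2_mx *%R u v.

Section Run.
Variables (sigma tau : rat -> rat).
Variables (S : Type) (dx w k : nat) (M : qrnn S dx w k) (x : seq S).

Definition preact (l : conv_layer dx w k) (t : nat) : 'rV[rat]_k :=
  conv l (map (embed M) x) t.

Definition qrnn_z (t : nat) : 'rV[rat]_k := map_mx tau (preact (layer_z M) t).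
Definition qrnn_f (t : nat) : 'rV[rat]_k := map_mx sigma (preact (layer_f M) t).
Definition qrnn_i (t : nat) : 'rV[rat]_k := map_mx sigma (preact (layer_i M) t).
Definition qrnn_o (t : nat) : 'rV[rat]_k := map_mx sigma (preact (layer_o M) t).

Fixpoint qrnn_c (t : nat) : 'rV[rat]_k :=
  if t is t'.+1 then
    odot (qrnn_f t) (qrnn_c t') + odot (qrnn_i t) (qrnn_z t)
  else 0.

Definition qrnn_h (t : nat) : 'rV[rat]_k :=
  if t is 0 then 0 else odot (qrnn_o t) (qrnn_c t).

End Run.

(* The value at 0 is immaterial: see [gates_saturated]. *)
Definition step (r : rat) : rat := if 0 < r then 1 else 0.

Definition gates_saturated (S : Type) (dx w k : nat) (M : qrnn S dx w k) :=
  forall (x : seq S) (t : nat) (j : 'I_k), (0 < t <= size x)%N ->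
    [/\ preact M x (layer_f M) t 0 j != 0,
        preact M x (layer_i M) t 0 j != 0
      & preact M x (layer_o M) t 0 j != 0].

Record sqrnn (S : Type) (dx w k : nat) := SQRNN {
  sqrnn_params :> qrnn S dx w k;
  sqrnn_saturated : gates_saturated sqrnn_params
}.

Definition final_state (S : Type) (dx w k : nat) (M : sqrnn S dx w k)
    (x : seq S) : 'rV[rat]_k :=
  qrnn_h step (@Num.sg rat) M x (size x).

Definition recognizes (S : Type) (dx w k : nat) (M : sqrnn S dx w k)
    (d : 'rV[rat]_k -> bool) (L : seq S -> Prop) : Prop :=
  forall x : seq S, d (final_state M x) = true <-> L x.

Inductive letter := letter_a | letter_b.

Definition anbn_prefix (x : seq letter) : Prop :=
  exists (n : nat) (y : seq letter),
    (0 < n)%N /\ x = nseq n letter_a ++ nseq n letter_b ++ y.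

(* Main.v *)
Require Import Defs.
From mathcomp Require Import all_boot all_order all_algebra.
From mathcomp Require Import ring.

(* The gates at time t depend only on the last w symbols, never on the state.
   Hence, after a fixed context s of length at least w, reading a word y either
   erases a given coordinate of c (some forget gate is 0) or adds to it a
   constant depending on s and y only.  With the blocks A = a^m and B = b^m,
   m > w, the words AB.AAB.AAB (in L) and AAB.AB.AAB (not in L) start with the
   same block and use the transitions AA, AB, BA equally often, so coordinates
   that are never erased agree on both; and each transition occurs in the common
   suffix BAAB, so an erased coordinate agrees as well. *)

Set Implicit Arguments.
Unset Strict Implicit.
Unset Printing Implicit Defensive.

Import GRing.Theory Num.Theory.
Local Open Scope ring_scope.

(** Induction on [y] from the right: after [s], gate and increment do not depend on [x], so a gate 0
    fixes the value for all [x], while a gate 1 keeps the alternative reached so far. *)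
Lemma local_affine_dichotomy (R : pzRingType) (T : Type) (w : nat)
    (c g a : seq T -> R) :
    (forall x e, c (rcons x e) = g (rcons x e) * c x + a (rcons x e)) ->
    (forall x, g x = 0 \/ g x = 1) ->
    (forall x s, (w <= size s)%N -> g (x ++ s) = g s) ->
    (forall x s, (w <= size s)%N -> a (x ++ s) = a s) ->
  forall s y, (w <= size s)%N ->
    (exists r, forall x, c ((x ++ s) ++ y) = r) \/
    (exists r, forall x, c ((x ++ s) ++ y) = c (x ++ s) + r).
Proof.
move=> cS g01 gL aL s y ws; elim/last_ind: y => [|y e IHy].
  by right; exists 0 => x; rewrite cats0 addr0.
have wse : (w <= size (s ++ rcons y e))%N.
  by rewrite size_cat (leq_trans ws) ?leq_addr.
have cE x : c ((x ++ s) ++ rcons y e) =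
    g (s ++ rcons y e) * c ((x ++ s) ++ y) + a (s ++ rcons y e).
  by rewrite -(gL x) // -(aL x) // catA -rcons_cat cS.
have [g0|g1] := g01 (s ++ rcons y e).
  by left; exists (a (s ++ rcons y e)) => x; rewrite cE g0 mul0r add0r.
case: IHy => -[r yr]; [left|right]; exists (r + a (s ++ rcons y e)) => x.
  by rewrite cE g1 mul1r yr.
by rewrite cE g1 mul1r yr addrA.
Qed.

Lemma local_affine_swap (R : comPzRingType) (T : Type) (w : nat)
    (c g a : seq T -> R) :
    (forall x e, c (rcons x e) = g (rcons x e) * c x + a (rcons x e)) ->
    (forall x, g x = 0 \/ g x = 1) ->
    (forall x s, (w <= size s)%N -> g (x ++ s) = g s) ->
    (forall x s, (w <= size s)%N -> a (x ++ s) = a s) ->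
  forall A B, (w <= size A)%N -> (w <= size B)%N ->
    c (A ++ B ++ A ++ A ++ B ++ A ++ A ++ B) =
    c (A ++ A ++ B ++ A ++ B ++ A ++ A ++ B).
Proof.
move=> cS g01 gL aL A B wA wB.
have dich := local_affine_dichotomy cS g01 gL aL.
(* The empty prefix gives the first block the shape [x ++ s] of the dichotomy. *)
rewrite -[X in c X]cat0s -[X in _ = c X]cat0s !catA.
case: (dich A A wA) => -[rAA AA]; case: (dich A B wA) => -[rAB AB];
  case: (dich B A wB) => -[rBA BA]; rewrite !(AA, AB, BA) //; ring.
Qed.

Section Runs.
Variables (S : Type) (dx w k : nat) (M : qrnn S dx w k).
Implicit Types (x y s : seq S) (l : conv_layer dx w k).

Lemma preact_prefix x y l t : (t <= size x)%N ->
  preact M (x ++ y) l t = preact M x l t.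
Proof.
move=> tx; rewrite /preact /conv map_cat; congr (_ + _).
apply: eq_bigr => j _; rewrite catA nth_cat size_cat size_nseq size_map.
by rewrite addnC -addSn leq_add.
Qed.

(** The last window lies inside [s], past both [x] and the zero padding. *)
Lemma preact_suffix x s l : (w <= size s)%N ->
  preact M (x ++ s) l (size (x ++ s)) = preact M s l (size s).
Proof.
move=> ws; rewrite /preact /conv map_cat; congr (_ + _).
apply: eq_bigr => j _; congr (_ *m _).
rewrite catA nth_cat [RHS]nth_cat !size_cat !size_nseq !size_map.
rewrite [(w + _)%N]addnC -addnA ltn_add2l !ltnNge (leq_trans ws) ?leq_addr //=.
by rewrite subnDl.
Qed.

Variables sigma tau : rat -> rat.

Lemma qrnn_c_prefix x y t : (t <= size x)%N ->
  qrnn_c sigma tau M (x ++ y) t = qrnn_c sigma tau M x t.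
Proof.
elim: t => //= t IHt tx; rewrite IHt 1?ltnW //.
by rewrite /qrnn_f /qrnn_i /qrnn_z !preact_prefix.
Qed.

Lemma qrnn_c_rcons x e :
  let y := rcons x e in
  qrnn_c sigma tau M y (size y) =
    odot (qrnn_f sigma M y (size y)) (qrnn_c sigma tau M x (size x)) +
    odot (qrnn_i sigma M y (size y)) (qrnn_z tau M y (size y)).
Proof. by rewrite /= size_rcons /= -cats1 qrnn_c_prefix. Qed.

Lemma qrnn_hE x : qrnn_h sigma tau M x (size x) =
  odot (qrnn_o sigma M x (size x)) (qrnn_c sigma tau M x (size x)).
Proof.
case: (size x) => //=; apply/rowP => j.
by rewrite !mxE mulr0.
Qed.

Lemma qrnn_h_swap A B : (forall r, sigma r = 0 \/ sigma r = 1) ->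
    (w <= size A)%N -> (w <= size B)%N ->
  let u := A ++ B ++ A ++ A ++ B ++ A ++ A ++ B in
  let v := A ++ A ++ B ++ A ++ B ++ A ++ A ++ B in
  qrnn_h sigma tau M u (size u) = qrnn_h sigma tau M v (size v).
Proof.
move=> sigma01 wA wB u v; rewrite !qrnn_hE; congr (odot _ _).
  (* Both words end in [B], which fills the window of the output gate. *)
  by rewrite /qrnn_o /u /v !catA !preact_suffix.
apply/rowP => j.
pose g x := qrnn_f sigma M x (size x) 0 j.
pose a x := qrnn_i sigma M x (size x) 0 j * qrnn_z tau M x (size x) 0 j.
apply: (@local_affine_swap _ _ w
          (fun x => qrnn_c sigma tau M x (size x) 0 j) g a) => //.
- by move=> x e; rewrite qrnn_c_rcons /g /a !mxE.
- by move=> x; rewrite /g mxE; apply: sigma01.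
- by move=> x s ws; rewrite /g /qrnn_f preact_suffix.
- by move=> x s ws; rewrite /a /qrnn_i /qrnn_z !preact_suffix.
Qed.

End Runs.

Lemma anbn_prefix_unbalanced p q z : (0 < q < p)%N ->
  ~ anbn_prefix (nseq p letter_a ++ nseq q letter_b ++ letter_a :: z).
Proof.
case/andP=> q0 qp [n [y [n0 eq_xy]]].
have nthE i := congr1 (fun s => nth letter_a s i) eq_xy.
(* The two words differ at position [p] if [p < n], at [n] if [n < p], and at [p + q] if [p = n],
   where the block of [b] on the right is still running because [q < p]. *)
case: (ltngtP p n) => [pn|np|pn].
- have := nthE p; rewrite !nth_cat !size_nseq ltnn subnn q0 pn !nth_nseq pn.
  by rewrite q0.
- have := nthE n; rewrite !nth_cat !size_nseq ltnn subnn n0 np !nth_nseq np.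
  by rewrite n0.
- have := nthE (p + q)%N; rewrite -pn !nth_cat !size_nseq !ltnNge leq_addr /=.
  by rewrite addKn leqnn /= subnn -ltnNge qp nth_nseq qp.
Qed.

Theorem theorem11 (dx w k : nat) (M : sqrnn letter dx w k)
    (d : 'rV[rat]_k -> bool) :
  ~ recognizes M d anbn_prefix.
Proof.
move=> rec.
(* Length [w.+1] rather than [w] keeps the blocks nonempty when [w] is 0. *)
pose A := nseq w.+1 letter_a; pose B := nseq w.+1 letter_b.
have step01 r : step r = 0 \/ step r = 1.
  by rewrite /step; case: ifP; [right|left].
have szA : (w <= size A)%N by rewrite size_nseq.
have szB : (w <= size B)%N by rewrite size_nseq.
pose u := A ++ B ++ A ++ A ++ B ++ A ++ A ++ B.
pose v := A ++ A ++ B ++ A ++ B ++ A ++ A ++ B.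
have eq_state : final_state M u = final_state M v by apply: qrnn_h_swap.
have Lu : anbn_prefix u by exists w.+1, (A ++ A ++ B ++ A ++ A ++ B).
have Lv : anbn_prefix v by apply/rec; rewrite -eq_state; apply/rec.
(* [v] opens with [A ++ A ++ B] and the first letter of the next [A]. *)
apply: (@anbn_prefix_unbalanced (w.+1 + w.+1) w.+1
          (nseq w letter_a ++ B ++ A ++ A ++ B)).
  by rewrite /= -addn1 leq_add2l.
by rewrite nseqD -catA.
Qed.
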